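(* For each function $f:\mathbb{N}\to\mathbb{N}$, the principle $\mathrm{WO}_f$ is true; that is: for each $k\in\mathbb{N}$ there exists $m\in\mathbb{N}$ such that, for all $b_0,\dots,b_m$ in $B_3^+$, if $\|b_s\|\le k+f(s)$ holds for every $s\le m$, then there exists $s<m$ such that $b_s>b_{s+1}$ fails.
   Context: $B_3$ is the $3$-strand braid group $\langle\sigma_1,\sigma_2\mid\sigma_1\sigma_2\sigma_1=\sigma_2\sigma_1\sigma_2\rangle$, and $B_3^+$ is the submonoid generated by $\sigma_1,\sigma_2$ (positive braids); $\Delta_3=\sigma_1\sigma_2\sigma_1$. Order: for braids $b,b'$, $b<b'$ holds if the braid $b^{-1}b'$ admits an expression by a (nonempty) braid word in the letters $\sigma_i^{\pm1}$ in which the generator $\sigma_i$ with highest index occurs only positively ($\sigma_i$ occurs but $\sigma_i^{-1}$ does not). Known: $<$ is a left-invariant linear order on $B_3$ whose restriction to $B_3^+$ is a well-order. Complexity: for $b\in B_3^+$, $\|b\|$ is the least $\ell\in\mathbb{N}$ such that $b$ is a left divisor of $\Delta_3^\ell$, i.e. $bb'=\Delta_3^\ell$ for some $b'\in B_3^+$. A sequence $(b_0,\dots,b_m)$ of braids is $(k,f)$-simple if $\|b_s\|\le k+f(s)$ for each $s$; $\mathrm{WO}_f$ asserts that, for each $k$, there is a bound on the length of $(k,f)$-simple descending sequences in $(B_3^+,<)$. *)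

(* Defs.v *)
From HB Require Import structures.
From mathcomp Require Import all_boot.
From mathcomp Require Import boolp.

Set Implicit Arguments.
Unset Strict Implicit.
Unset Printing Implicit Defensive.

Local Open Scope quotient_scope.
Local Open Scope group_scope.

(* The letter (i, true) stands for sigma_(i+1), and (i, false) for its
   inverse. *)
Definition letter : Type := ('I_2 * bool)%type.
Definition word := seq letter.

Definition g1 : 'I_2 := ord0.
Definition g2 : 'I_2 := ord_max.

Inductive braid_eq : word -> word -> Prop :=
| braid_eq_refl w : braid_eq w w
| braid_eq_sym v w : braid_eq v w -> braid_eq w v
| braid_eq_trans u v w : braid_eq u v -> braid_eq v w -> braid_eq u w
| braid_eq_cat u u' v v' :
    braid_eq u u' -> braid_eq v v' -> braid_eq (u ++ v) (u' ++ v')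
| braid_eq_free i e : braid_eq [:: (i, e); (i, ~~ e)] [::]
| braid_eq_rel :
    braid_eq [:: (g1, true); (g2, true); (g1, true)]
             [:: (g2, true); (g1, true); (g2, true)].

Definition braid_eqb : rel word := fun v w => `[< braid_eq v w >].

Lemma braid_eqb_refl : reflexive braid_eqb.
Proof. by move=> w; apply/asboolP; constructor. Qed.

Lemma braid_eqb_sym : symmetric braid_eqb.
Proof. by move=> v w; apply/asboolP/asboolP; apply: braid_eq_sym. Qed.

Lemma braid_eqb_trans : transitive braid_eqb.
Proof.
move=> v u w /asboolP uv /asboolP vw; apply/asboolP.
exact: braid_eq_trans uv vw.
Qed.

Canonical braid_equiv :=
  EquivRel braid_eqb braid_eqb_refl braid_eqb_sym braid_eqb_trans.

Definition B3 : Type := {eq_quot braid_eqb}.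
HB.instance Definition _ := Choice.on B3.
HB.instance Definition _ := EqQuotient.on B3.

Definition braid (w : word) : B3 := \pi_B3 w.

Lemma braidP v w : braid v = braid w <-> braid_eq v w.
Proof.
split=> [/eqmodP /asboolP //|vw].
by apply/eqmodP; apply/asboolP.
Qed.

Lemma braid_repr (b : B3) : braid (repr b) = b.
Proof. exact: reprK. Qed.

Definition inv_word (w : word) : word := rev [seq (l.1, ~~ l.2) | l <- w].

Lemma inv_wordK : involutive inv_word.
Proof.
move=> w; rewrite /inv_word map_rev revK -map_comp -[RHS]map_id.
by apply: eq_map => -[i e] /=; rewrite negbK.
Qed.

Lemma inv_word_cat v w : inv_word (v ++ w) = inv_word w ++ inv_word v.
Proof. by rewrite /inv_word map_cat rev_cat. Qed.

Lemma braid_eq_mulV w : braid_eq (w ++ inv_word w) [::].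
Proof.
elim: w => [|[i e] w IHw]; first by constructor.
rewrite -cat1s inv_word_cat -catA (catA w).
apply: braid_eq_trans (braid_eq_free i e).
apply: (@braid_eq_cat _ [:: (i, e)] _ [:: (i, ~~ e)]); first by constructor.
exact: (braid_eq_cat IHw (braid_eq_refl _)).
Qed.

Lemma braid_eq_mulVl w : braid_eq (inv_word w ++ w) [::].
Proof. by rewrite -{2}(inv_wordK w); apply: braid_eq_mulV. Qed.

Lemma braid_eq_inv_word v w :
  braid_eq v w -> braid_eq (inv_word v) (inv_word w).
Proof.
move=> vw; apply: (@braid_eq_trans _ (inv_word v ++ (w ++ inv_word w))).
  rewrite -[X in braid_eq X]cats0; apply: braid_eq_cat; first by constructor.
  exact/braid_eq_sym/braid_eq_mulV.
rewrite catA -[X in braid_eq _ X]cat0s.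
apply: braid_eq_cat; last by constructor.
apply: braid_eq_trans (braid_eq_mulVl v); apply: braid_eq_cat.
  by constructor.
exact: braid_eq_sym.
Qed.

Definition B3_one : B3 := braid [::].
Definition B3_inv (b : B3) : B3 := braid (inv_word (repr b)).
Definition B3_mul (b c : B3) : B3 := braid (repr b ++ repr c).

Lemma B3_mulE v w : B3_mul (braid v) (braid w) = braid (v ++ w).
Proof. by apply/braidP/braid_eq_cat; apply/braidP/braid_repr. Qed.

Lemma B3_invE w : B3_inv (braid w) = braid (inv_word w).
Proof. by apply/braidP/braid_eq_inv_word/braidP/braid_repr. Qed.

Lemma B3_mulA : associative B3_mul.
Proof.
move=> b c d; rewrite -(braid_repr b) -(braid_repr c) -(braid_repr d).
by rewrite !B3_mulE catA.
Qed.

Lemma B3_mul1b : left_id B3_one B3_mul.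
Proof. by move=> b; rewrite -(braid_repr b) B3_mulE. Qed.

Lemma B3_mulb1 : right_id B3_one B3_mul.
Proof. by move=> b; rewrite -(braid_repr b) B3_mulE cats0. Qed.

Lemma B3_mulbV : right_inverse B3_one B3_inv B3_mul.
Proof.
move=> b; rewrite -(braid_repr b) B3_invE B3_mulE.
exact/braidP/braid_eq_mulV.
Qed.

Lemma B3_mulVb : left_inverse B3_one B3_inv B3_mul.
Proof.
move=> b; rewrite -(braid_repr b) B3_invE B3_mulE.
exact/braidP/braid_eq_mulVl.
Qed.

HB.instance Definition _ :=
  isGroup.Build B3 B3_mulA B3_mul1b B3_mulb1 B3_mulVb B3_mulbV.

Definition sigma (i : 'I_2) : B3 := braid [:: (i, true)].

Lemma braid_nil : braid [::] = 1.
Proof. by []. Qed.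

Lemma braid_cat v w : braid (v ++ w) = braid v * braid w.
Proof. by rewrite -B3_mulE. Qed.

Lemma sigma_rel :
  sigma g1 * sigma g2 * sigma g1 = sigma g2 * sigma g1 * sigma g2.
Proof. by rewrite /sigma -!braid_cat; apply/braidP; apply: braid_eq_rel. Qed.

Inductive positive_braid : B3 -> Prop :=
| positive_one : positive_braid 1
| positive_sigma i : positive_braid (sigma i)
| positive_mul b c :
    positive_braid b -> positive_braid c -> positive_braid (b * c).

Definition B3pos : {pred B3} := fun b => `[< positive_braid b >].

Lemma positive_monoid_closed : monoid_closed B3pos.
Proof.
split=> [|b c /asboolP pb /asboolP pc]; apply/asboolP; by constructor.
Qed.

Record B3plus := PositiveBraid {
  braid_of :> B3;
  braid_ofP : braid_of \in B3pos }.

HB.instance Definition _ := [isSub for braid_of].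
HB.instance Definition _ := [Choice of B3plus by <:].
HB.instance Definition _ :=
  SubChoice_isSubMonoid.Build B3 B3pos B3plus positive_monoid_closed.

Lemma sigma_positive i : sigma i \in B3pos.
Proof. by apply/asboolP; constructor. Qed.

Definition sigma_plus (i : 'I_2) : B3plus := PositiveBraid (sigma_positive i).

Definition Delta3 : B3plus := sigma_plus g1 * sigma_plus g2 * sigma_plus g1.

Definition divides_Delta (b : B3plus) (l : nat) : Prop :=
  exists b' : B3plus, b * b' = Delta3 ^+ l.

Definition divides_Deltab (b : B3plus) : pred nat :=
  fun l => `[< divides_Delta b l >].

Lemma Delta3_comm (b : B3plus) l :
  exists b' : B3plus, b * Delta3 ^+ l = Delta3 ^+ l * b'.
Proof.
elim: l b => [|l IHl] b; first by exists b; rewrite !expg0 mulg1 mul1g.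
suff [c bc] : exists c : B3plus, b * Delta3 = Delta3 * c.
  have [d cd] := IHl c; exists d.
  by rewrite expgS mulgA bc -mulgA cd mulgA.
have rel : sigma_plus g1 * sigma_plus g2 * sigma_plus g1
         = sigma_plus g2 * sigma_plus g1 * sigma_plus g2.
  by apply: val_inj; rewrite /= sigma_rel.
case: b => b pb; move/asboolP: (pb) => hb.
elim: hb pb => {b} [|i|b c hb IHb hc IHc] pb.
- by exists 1; apply: val_inj; rewrite /= mul1g mulg1.
- have -> : PositiveBraid pb = sigma_plus i by apply: val_inj.
  have [->|->] : i = g1 \/ i = g2.
    by case: i {pb} => -[|[|//]] ilt; [left|right]; apply: val_inj.
  + by exists (sigma_plus g2); rewrite /Delta3 {1}rel !mulgA.
  + by exists (sigma_plus g1); rewrite /Delta3 {2}rel !mulgA.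
- have pb' : b \in B3pos by apply/asboolP.
  have pc' : c \in B3pos by apply/asboolP.
  have [b' bb'] := IHb pb'; have [c' cc'] := IHc pc'.
  have -> : PositiveBraid pb = PositiveBraid pb' * PositiveBraid pc'.
    exact: val_inj.
  by exists (b' * c'); rewrite -mulgA cc' mulgA bb' mulgA.
Qed.

Lemma divides_Delta_exists (b : B3plus) : exists l, divides_Deltab b l.
Proof.
suff [l bl] : exists l, divides_Delta b l by exists l; apply/asboolP.
case: b => b pb; move/asboolP: (pb) => hb.
elim: hb pb => {b} [|i|b c hb IHb hc IHc] pb.
- by exists 0%N, 1; apply: val_inj; rewrite /= mulg1.
- exists 1%N; have -> : PositiveBraid pb = sigma_plus i by apply: val_inj.
  have [->|->] : i = g1 \/ i = g2.
    by case: i {pb} => -[|[|//]] ilt; [left|right]; apply: val_inj.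
  + by exists (sigma_plus g2 * sigma_plus g1); rewrite expg1 mulgA.
  + exists (sigma_plus g1 * sigma_plus g2); rewrite expg1 mulgA.
    by apply: val_inj; rewrite /= sigma_rel.
- have pb' : b \in B3pos by apply/asboolP.
  have pc' : c \in B3pos by apply/asboolP.
  have [l [b' bb']] := IHb pb'; have [n [c' cc']] := IHc pc'.
  have [d bd] := Delta3_comm b' n; exists (l + n)%N, (c' * d).
  have -> : PositiveBraid pb = PositiveBraid pb' * PositiveBraid pc'.
    exact: val_inj.
  by rewrite -mulgA (mulgA _ c') cc' -bd mulgA bb' expgnDr.
Qed.

Definition complexity (b : B3plus) : nat := ex_minn (divides_Delta_exists b).

(* sigma_(i+1) is the generator of highest index occurring in w, and it occurs
   only positively; this forces w to be nonempty. *)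
Definition main_generator_positive (w : word) : Prop :=
  exists i : 'I_2, [/\ (i, true) \in w, (i, false) \notin w
    & forall l, l \in w -> (l.1 <= i)%N].

Definition braid_lt (b b' : B3) : Prop :=
  exists2 w : word, main_generator_positive w & braid w = b^-1 * b'.

(* The default value 1 of nth is never reached, here and in WO. *)
Definition simple_seq (k : nat) (f : nat -> nat) (b : seq B3plus) : Prop :=
  forall s, (s < size b)%N ->
    (complexity (@nth B3plus 1%g b s) <= k + f s)%N.

Definition WO (f : nat -> nat) : Prop :=
  forall k : nat, exists m : nat, forall b : seq B3plus,
    size b = m.+1 -> simple_seq k f b ->
    exists2 s, (s < m)%N &
      ~ braid_lt (@nth B3plus 1%g b s.+1) (@nth B3plus 1%g b s).

(* Main.v *)
Require Import Defs.
From mathcomp Require Import all_boot all_order all_algebra.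
From mathcomp Require Import boolp zify ring lra.

Set Implicit Arguments.
Unset Strict Implicit.
Unset Printing Implicit Defensive.

Import Order.TTheory GRing.Theory Num.Theory.

(** The proof has two halves: positive braids contain no infinite descending
    sequence, and this is turned into a uniform bound by compactness.

    For the first half, [B3] acts on a line [L] by increasing bijections: its
    image [PSL(2, Z)] acts on the projective line over the rationals, and [L]
    is the preimage of that circle in the universal cover. The generators
    [sigma_1] and [sigma_2] lift to parabolic maps that move no point downwards; [sigma_1]
    fixes the point [origin], while [sigma_2] raises it. So a braid word in
    which [sigma_2] occurs, and occurs only positively, raises [origin], and if
    [b < b'] then either [b origin < b' origin], or [b' = b sigma_1 ^ n] with
    [n > 0], in which case [b origin = b' origin] and [b] has the smaller
    degree. Hence the braid order is contained in the order that compares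
    positive words lexicographically by the image of [origin] and by length
    ([braid_lt_rank]).

    That order is well-founded on words ([rank_wf]) because prepending a letter
    increases a word, and words that compare after prepending the same letter
    compared in the same way before. These two facts suffice over any finite
    alphabet ([word_order_wf]): if [W] is the well-founded part of such an order,
    each word outside [W] dominates a word [i :: u] that leaves [W], that is, with
    [u] in [W] and [i :: u] outside. For a fixed [i] there is a minimal such
    word because [W] is well-founded, and for all [i] together because there are
    finitely many letters. Everything below a minimal word leaving [W] lies in
    [W], so this word is in [W] too, a contradiction.

    For the second half, a positive braid that divides [Delta_3 ^ l] has length
    at most [3 l], so at each step only finitely many positive words are
    available; well-founded induction then bounds the length of descending
    sequences ([bounded_descent]). *)

(** * Well-founded orders on words *)

Lemma Acc_minimal (T : Type) (R : T -> T -> Prop) (P : T -> Prop) (x : T) :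
  Acc R x -> P x ->
  exists y, [/\ Acc R y, P y & forall z, P z -> ~ R z y].
Proof.
elim=> {}x Ax IHx Px.
have [[z Rzx Pz]|noz] := pselect (exists2 z, R z x & P z).
  exact: IHx Rzx Pz.
exists x; split=> // z Pz Rzx; exact: noz (ex_intro2 _ _ z Rzx Pz).
Qed.

Section WordOrder.

Variables (A : finType) (R : seq A -> seq A -> Prop).
Hypothesis Rirr : forall u, ~ R u u.
Hypothesis Rtrans : forall u v w, R u v -> R v w -> R u w.
Hypothesis R_cons : forall i u, R u (i :: u).
Hypothesis R_behead : forall i u v, R (i :: u) (i :: v) -> R u v.

Definition exits (i : A) (u : seq A) : Prop := Acc R u /\ ~ Acc R (i :: u).

(** The empty word lies below all other words, since prepending letters
    increases a word. *)
Lemma Acc_nil : Acc R [::].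
Proof.
constructor=> v Rv0; suff: R [::] [::] by move/Rirr.
elim: v Rv0 => // i v IHv Riv0.
exact/IHv/(Rtrans (R_cons i v)).
Qed.

(** Read from its last letter to its first, an inaccessible word starts from
    the accessible empty word, so some suffix of it is the first to be
    inaccessible; suffixes are never larger than the word. *)
Lemma exits_below w : ~ Acc R w ->
  exists i u, exits i u /\ (i :: u = w \/ R (i :: u) w).
Proof.
elim: w => [/(_ Acc_nil)//|i w IHw niw].
have [Aw|/IHw[j [u [ju le_w]]]] := pselect (Acc R w).
  by exists i, w; split; last left.
exists j, u; split=> //; right.
by case: le_w => [->|juw]; [exact: R_cons | exact: Rtrans juw (R_cons i w)].
Qed.

(** The accessible part has minimal elements, and cancelling a common first
    letter transfers this to the exits through that letter. Passing to an exit
    below the current one keeps it minimal for the letters already treated,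
    by transitivity. *)
Lemma minimal_exit (s : seq A) i0 u0 : exits i0 u0 ->
  exists i u, exits i u /\
    forall j v, j \in s -> exits j v -> ~ R (j :: v) (i :: u).
Proof.
move=> ex0; elim: s => [|k s [i [u [ex_iu min_iu]]]]; first by exists i0, u0.
pose P v := ~ Acc R (k :: v) /\ R (k :: v) (i :: u).
have [[v Av Pv]|noP] := pselect (exists2 v, Acc R v & P v); last first.
  exists i, u; split=> // j v.
  rewrite inE => /predU1P[->|js]; last exact: min_iu.
  by move=> [Av nAv] Rvu; apply: noP; exists v.
have [y [Ay [nAy Ryu] miny]] := Acc_minimal Av Pv.
exists k, y; split=> // j z; rewrite inE => /predU1P[->|js] ex_jz Rzy.
  apply: (miny z) (R_behead Rzy).
  by split; [case: ex_jz | exact: Rtrans Rzy Ryu].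
exact: min_iu js ex_jz (Rtrans Rzy Ryu).
Qed.

(** All words below a minimal exit are accessible, for otherwise
    [exits_below] would produce a smaller exit; but then the exit itself is
    accessible. *)
Lemma word_order_wf : well_founded R.
Proof.
move=> w; apply: contrapT => /exits_below[i0 [u0 [/(minimal_exit (enum A))]]].
case=> i [u [[_ nAiu] min_iu]] _; apply: nAiu; constructor=> x Rxu.
apply: contrapT => /exits_below[j [v [ex_jv le_x]]].
apply: (min_iu j v) => //; first by rewrite mem_enum.
by case: le_x => [->//|/Rtrans]; apply.
Qed.

End WordOrder.

(** * Bounding descending sequences by finite branching *)

(** Finite branching, by well-founded induction: the bound for [x] is one more
    than the largest bound over the finitely many possible successors of [x].
    The shift [s] is there because the successors are constrained by the next
    set of the family. *)
Lemma bounded_descent_from (T : eqType) (R : T -> T -> Prop)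
    (F : nat -> seq T) :
  well_founded R -> forall x s, exists m, forall c : nat -> T, c 0 = x ->
    (forall i, i <= m -> c i \in F (s + i)) ->
    exists2 i, i < m & ~ R (c i.+1) (c i).
Proof.
move=> wfR x; elim: (wfR x) => {}x _ IHx s.
have /choice[m mP] : forall y, exists m,
    R y x -> forall c : nat -> T, c 0 = y ->
    (forall i, i <= m -> c i \in F (s.+1 + i)) ->
    exists2 i, i < m & ~ R (c i.+1) (c i).
  move=> y; have [/IHx/(_ s.+1)[m]|nRyx] := pselect (R y x); first by exists m.
  by exists 0.
exists (\max_(y <- F s.+1) m y).+1 => c c0 cF.
have [Rc|nRc] := pselect (R (c 1) (c 0)); last by exists 0.
have lemax : m (c 1) <= \max_(y <- F s.+1) m y.
  by apply: leq_bigmax_seq => //; have:= cF 1 isT; rewrite addn1.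
have [i ltim nR] : exists2 i, i < m (c 1) & ~ R (c i.+2) (c i.+1).
  apply: (mP (c 1) _ (fun i => c i.+1)) => [|//|i leim]; first by rewrite -c0.
  by rewrite addSnnS; apply: cF; apply: leq_trans lemax.
by exists i.+1 => //; rewrite ltnS (leq_trans ltim).
Qed.

Lemma bounded_descent (T : eqType) (R : T -> T -> Prop) (F : nat -> seq T) :
  well_founded R -> exists m, forall c : nat -> T,
    (forall i, i <= m -> c i \in F i) ->
    exists2 i, i < m & ~ R (c i.+1) (c i).
Proof.
move=> /bounded_descent_from-/(_ F) bnd.
have /choice[m mP] := fun x => bnd x 0.
exists (\max_(x <- F 0) m x) => c cF.
have lemax : m (c 0) <= \max_(x <- F 0) m x.
  by apply: leq_bigmax_seq; rewrite ?cF.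
have [|i ltim nR] := mP (c 0) c erefl.
  by move=> i leim; apply: cF; apply: leq_trans lemax.
by exists i => //; apply: leq_trans lemax.
Qed.

(** * The action on the lifted projective line *)

Local Open Scope ring_scope.

Lemma generatorP (i : 'I_2) : i = g1 \/ i = g2.
Proof. by case: i => -[|[|//]] ilt; [left|right]; apply: val_inj. Qed.

(** The circle is cut into two arcs exchanged by the half-turn [x |-> - 1 / x],
    which is the image of [Delta_3]: the slopes in [0, +oo), with coordinate
    [y = x], and those in [-oo, 0), with coordinate [y = - 1 / x]. The point
    [(k, y)] of the universal cover has coordinate [y >= 0] on the [k]-th arc,
    arcs of the second kind having even index. So [Delta_3] acts by
    [(k, y) |-> (k + 1, y)], and the order of the line is lexicographic. *)
Notation point := (int *l rat)%type.

(** On each arc one of the generators is a translation [y |-> y + 1] and the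
    other is its conjugate [y |-> y / (1 - y)] by the half-turn. The half-turn
    swaps [sigma_1] and [sigma_2], whence the dependence on the parity. *)
Definition expands (i : 'I_2) (k : int) : bool := (i == g2) (+) odd `|k|%N.

(** In slopes, [sigma_1] is [x |-> x + 1] and [sigma_2] is
    [x |-> x / (1 - x)]. The last case is that of a point pushed across the
    upper end of its arc. *)
Definition up (i : 'I_2) (x : point) : point :=
  let: (k, y) := x in
  if expands i k then (k, y + 1)
  else if y < 1 then (k, y / (1 - y)) else (k + 1, 1 - y^-1).

Definition down (i : 'I_2) (x : point) : point :=
  let: (k, y) := x in
  if expands i k then if y < 1 then (k - 1, (1 - y)^-1) else (k, y - 1)
  else (k, y / (1 + y)).

(** A pair with a negative second component stands for no point of the line, and
    there [up] and [down] need not be inverse to each other. *)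
Definition line : {pred point} := fun x => 0 <= x.2.

Lemma expandsD1 i k : expands i (k + 1) = ~~ expands i k.
Proof. rewrite /expands. lia. Qed.

Lemma expandsB1 i k : expands i (k - 1) = ~~ expands i k.
Proof. rewrite /expands. lia. Qed.

Lemma up_line i x : x \in line -> up i x \in line.
Proof.
case: x => k y; rewrite /line !unfold_in /= => y0.
case: expands => /=; first lra.
case: ltP => [y1|y1] /=; first by rewrite divr_ge0 //; lra.
by rewrite subr_ge0 invf_le1 //; lra.
Qed.

Lemma down_line i x : x \in line -> down i x \in line.
Proof.
case: x => k y; rewrite /line !unfold_in /= => y0.
case: expands => /=; last by rewrite divr_ge0 //; lra.
case: ltP => y1 /=; last lra.
by rewrite invr_ge0; lra.
Qed.

Lemma upK i : {in line, cancel (up i) (down i)}.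
Proof.
case=> k y; rewrite /line !unfold_in /= => y0.
case: ifPn => ex /=.
  by rewrite ex; case: ltP => y1; [exfalso; lra | congr (_, _); lra].
case: ltP => y1 /=.
  by rewrite (negPf ex); congr (_, _); field; apply/andP; split; lra.
rewrite expandsD1 ex ifT.
  by congr (_, _); [lia | rewrite opprB addrC subrK invrK].
by rewrite ltrBlDr ltrDl invr_gt0; lra.
Qed.

Lemma downK i : {in line, cancel (down i) (up i)}.
Proof.
case=> k y; rewrite /line !unfold_in /= => y0.
case: ifPn => ex /=.
  case: ltP => y1 /=; last by rewrite ex; congr (_, _); lra.
  rewrite expandsB1 ex /= ifF.
    by rewrite invrK; congr (_, _); [lia | lra].
  by apply/negbTE; rewrite -leNgt invf_ge1; lra.
rewrite (negPf ex) ifT; first by congr (_, _); field; apply/andP; split; lra.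
by rewrite ltr_pdivrMr; lra.
Qed.

Lemma expands_g2 k : expands g2 k = ~~ expands g1 k.
Proof. by rewrite /expands /=; case: odd. Qed.

(** Both sides of the braid relation are the action of [Delta_3], the shift by
    one arc. *)
Lemma up_up_up i j k y : expands i k -> ~~ expands j k -> 0 <= y ->
  up i (up j (up i (k, y))) = (k + 1, y) /\
  up j (up i (up j (k, y))) = (k + 1, y).
Proof.
move=> exi exj y0; split.
  rewrite /up exi (negPf exj) ifF; last lra.
  rewrite expandsD1 exi /= ifT.
    by congr (_, _); field; apply/andP; split; lra.
  by rewrite ltrBlDr ltrDl invr_gt0; lra.
rewrite /up (negPf exj); case: ltP => y1.
  rewrite exi (negPf exj) ifF.
    by congr (_, _); field; lra.
  apply/negbTE; rewrite -leNgt lerDr divr_ge0 //; lra.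
rewrite expandsD1 exi /= ifT; last by rewrite ltrBlDr ltrDl invr_gt0; lra.
by rewrite expandsD1 exj; congr (_, _); field; lra.
Qed.

Lemma up_braid x : x \in line ->
  up g1 (up g2 (up g1 x)) = up g2 (up g1 (up g2 x)).
Proof.
case: x => k y y0; have [ex1|ex1] := boolP (expands g1 k).
  have ex2 : ~~ expands g2 k by rewrite expands_g2 ex1.
  by have [e1 e2] := up_up_up ex1 ex2 y0; exact: etrans e1 (esym e2).
have ex2 : expands g2 k by rewrite expands_g2.
by have [e2 e1] := up_up_up ex2 ex1 y0; exact: etrans e1 (esym e2).
Qed.

Lemma lt_pointP (k k' : int) (y y' : rat) :
  reflect (k < k' \/ k = k' /\ y < y') (((k, y) : point) < (k', y'))%O.
Proof.
rewrite ltxi_pair; apply: (iffP andP) => [[+ /implyP]|].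
  by rewrite le_eqVlt => /predU1P[->|]; [right; split=> //; auto | left].
case=> [ltk|[-> lty]]; last by rewrite lexx lty.
by rewrite ltW // leNgt ltk.
Qed.

(** Order could only be lost between a point pushed into the next arc and a
    point that is already there. But on the next arc the generator is a
    translation: the pushed point arrives below [1], and the other one is sent
    to [1] or above. *)
Lemma up_lt i : {in line &, {homo up i : x y / (x < y)%O}}.
Proof.
case=> k y [k' y']; rewrite /line !unfold_in /= => y0 y'0.
case/lt_pointP=> [ltk|[<- lty]].
  case: ifPn => ex.
    by case: ifPn => ex'; last case: ifPn => y1'; apply/lt_pointP; left; lia.
  case: (ltP y 1) => y1.
    by case: ifPn => ex'; last case: ifPn => y1'; apply/lt_pointP; left; lia.
  have yV : 0 < y^-1 by rewrite invr_gt0; lra.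
  have [->|nek] := eqVneq (k' : int) ((k : int) + 1).
    by rewrite (expandsD1 i k) ex; apply/lt_pointP; right; split=> //; lra.
  by case: ifPn => ex'; last case: ifPn => y1'; apply/lt_pointP; left; lia.
case: ifPn => ex; first by apply/lt_pointP; right; split=> //; lra.
case: (ltP y 1) => y1; case: (ltP y' 1) => y1'; apply/lt_pointP.
- right; split=> //; rewrite ltr_pdivrMr ?subr_gt0 // mulrAC.
  by rewrite ltr_pdivlMr ?subr_gt0 //; lra.
- by left; lia.
- by exfalso; lra.
- right; split=> //; rewrite ltrD2l ltrN2 ltf_pV2 ?posrE //; lra.
Qed.

Lemma up_le_mono i : {in line &, {mono up i : x y / (x <= y)%O}}.
Proof. exact: le_mono_in (@up_lt i). Qed.

Lemma up_lt_mono i : {in line &, {mono up i : x y / (x < y)%O}}.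
Proof. exact: leW_mono_in (@up_le_mono i). Qed.

Lemma up_ge i x : x \in line -> (x <= up i x)%O.
Proof.
case: x => k y; rewrite /line !unfold_in /= => y0; rewrite le_eqVlt.
case: ifPn => ex.
  by apply/orP; right; apply/lt_pointP; right; split=> //; lra.
case: (ltP y 1) => y1; last by apply/orP; right; apply/lt_pointP; left; lia.
have [->|ny0] := eqVneq y 0; first by rewrite mul0r eqxx.
apply/orP; right; apply/lt_pointP; right; split=> //.
have y_gt0 : 0 < y by rewrite lt_neqAle eq_sym ny0.
by rewrite ltr_pdivlMr ?subr_gt0 // mulrBr mulr1 ltrBlDr ltrDl mulr_gt0.
Qed.

(** The point at infinity, which is the lower end of the arc of index [0] and is
    fixed by [x |-> x + 1]. *)
Definition origin : point := (0, 0).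

Lemma up1_origin : up g1 origin = origin.
Proof. by []. Qed.

Lemma up2_origin : (origin < up g2 origin)%O.
Proof. by []. Qed.

Definition act (w : word) (x : point) : point :=
  foldr (fun l => if l.2 then up l.1 else down l.1) x w.

Lemma act_cat v w x : act (v ++ w) x = act v (act w x).
Proof. exact: foldr_cat. Qed.

Lemma act_line w x : x \in line -> act w x \in line.
Proof.
move=> xl; elim: w => //= -[i []] w IHw /=; [exact: up_line|exact: down_line].
Qed.

Lemma act_braid_eq v w : braid_eq v w -> {in line, act v =1 act w}.
Proof.
elim=> {v w} [//|v w _ IH|u v w _ IHu _ IHv|u u' v v' _ IHu _ IHv|i e|] x xl.
- by rewrite IH.
- by rewrite IHu // IHv.
- by rewrite !act_cat IHv // IHu // act_line.
- by case: e; [exact: downK | exact: upK].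
- exact: up_braid.
Qed.

(** * The length homomorphism *)

Definition degree (w : word) : int :=
  (count (fun l => l.2) w)%:Z - (count (fun l => ~~ l.2) w)%:Z.

Lemma degree_cat v w : degree (v ++ w) = degree v + degree w.
Proof. rewrite /degree !count_cat. lia. Qed.

Lemma degree_braid_eq v w : braid_eq v w -> degree v = degree w.
Proof.
elim=> {v w} [//|//|u v w _ -> _ ->//|u u' v v' _ IHu _ IHv|i e|//].
  by rewrite !degree_cat IHu IHv.
by case: e.
Qed.

Definition pos_word (u : seq 'I_2) : word := [seq (i, true) | i <- u].

Lemma degree_pos u : degree (pos_word u) = (size u)%:Z.
Proof.
rewrite /degree !count_map /preim /= count_predT.
by rewrite (eq_count (a2 := pred0)) // count_pred0 subr0.
Qed.

(** * Ranking positive words *)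

(** The length is needed to tell [b] from [b sigma_1 ^ n], which send [origin]
    to the same point. *)
Definition rank (u : seq 'I_2) : (point *l nat)%type :=
  (act (pos_word u) origin, size u).

Lemma rank_wf : well_founded (fun u v => (rank u < rank v)%O).
Proof.
apply: word_order_wf => [u|u v w|i u|i u v].
- by rewrite ltxx.
- exact: lt_trans.
- rewrite ltxi_pair /= up_ge ?act_line //=.
  by rewrite ltEnat /= ltnSn implybT.
- by rewrite !ltxi_pair /= !up_le_mono ?act_line // !ltEnat.
Qed.

(** The inverse of [sigma_1] is harmless because it fixes [origin] and is
    increasing. *)
Lemma act_sigma2_positive w : (g2, false) \notin w ->
  (origin <= act w origin)%O /\
  ((g2, true) \in w -> (origin < act w origin)%O).
Proof.
have ol : origin \in line by [].
elim: w => [//|[i e] w IHw]; rewrite !inE negb_or => /andP[ne /IHw[le_o lt_o]].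
have := act_line w ol; rewrite /act /= -/(act w origin).
move: (act w origin) le_o lt_o => z le_o lt_o zl.
have [i1|i2] := generatorP i.
  have up1 x : x \in line -> (origin <= x)%O = (origin <= up g1 x)%O /\
      (origin < x)%O = (origin < up g1 x)%O.
    by move=> xl; rewrite -{2 4}up1_origin up_le_mono ?up_lt_mono.
  rewrite i1 /=; case: e {ne} => /=.
    by have [<- <-] := up1 _ zl.
  have [-> ->] := up1 _ (down_line g1 zl).
  by rewrite downK.
rewrite i2 in ne *; case: e ne => //= _.
have lt_up : (origin < up g2 z)%O.
  by apply: lt_le_trans up2_origin _; rewrite up_le_mono.
by rewrite ltW.
Qed.

Lemma act_pos_lt u : {in line &, {mono act (pos_word u) : x y / (x < y)%O}}.
Proof.
move=> x y xl yl; elim: u => //= i u IHu.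
by rewrite up_lt_mono ?act_line.
Qed.

Lemma act_sigma1_power w :
  (forall l, l \in w -> l = (g1, true)) -> act w origin = origin.
Proof.
elim: w => // l w IHw w1; rewrite (w1 l) ?mem_head //.
have -> : act ((g1, true) :: w) origin = up g1 (act w origin) by [].
by rewrite IHw // => l' l'w; apply: w1; rewrite inE l'w orbT.
Qed.

(** The two alternatives for the index of the main generator correspond to the
    two components of the rank: if it is [sigma_2] the image of [origin] grows,
    and if it is [sigma_1] the quotient is a power of [sigma_1], which fixes
    [origin] and increases the length. *)
Lemma braid_lt_rank u v :
  braid_lt (braid (pos_word u)) (braid (pos_word v)) -> (rank u < rank v)%O.
Proof.
case=> w [i [iw niw le_i]] /(congr1 (fun b => (braid (pos_word u) * b)%g)).
rewrite mulgA mulgV mul1g -braid_cat => /braidP uwv.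
have ol : origin \in line by [].
have := degree_braid_eq uwv; rewrite degree_cat !degree_pos => size_v.
have := act_braid_eq uwv ol; rewrite act_cat => act_v.
rewrite ltxi_pair /= -act_v ltEnat /=.
have [i1|i2] := generatorP i.
  have w1 l : l \in w -> l = (g1, true).
    case: l => j [] jw; have := le_i _ jw; rewrite i1 leqn0 => /eqP j0.
      by congr (_, _); apply: val_inj.
    by case/negP: niw; rewrite i1 (_ : g1 = j) //; apply: val_inj.
  rewrite (act_sigma1_power w1).
  have deg_w : (0 < degree w)%R.
    rewrite /degree (@eq_in_count _ (fun l => ~~ l.2) pred0) => [|l /w1->//].
    rewrite count_pred0 subr0 ltz_nat -has_count.
    by apply/hasP; exists (i, true).
  by rewrite lexx /=; lia.
rewrite i2 in iw niw.
have lt_w : (origin < act w origin)%O.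
  by have [_] := act_sigma2_positive niw; apply.
have lt_uw := lt_w; rewrite -(act_pos_lt u) ?act_line // in lt_uw.
by rewrite ltW // leNgt lt_uw.
Qed.

(** * Finitely many braids of bounded complexity *)

Definition deg (b : B3) : int := degree (repr b).

Lemma deg_braid w : deg (braid w) = degree w.
Proof. by apply/degree_braid_eq/braidP/braid_repr. Qed.

Lemma degM b c : deg (b * c)%g = deg b + deg c.
Proof.
by rewrite -(braid_repr b) -(braid_repr c) -braid_cat !deg_braid degree_cat.
Qed.

Lemma deg_Delta3X l : deg (Delta3 ^+ l)%g = (3 * l)%:Z.
Proof.
elim: l => [|l IHl]; first by rewrite deg_braid.
by rewrite expgS /= !degM IHl !deg_braid /degree /=; lia.
Qed.

Lemma positive_braid_word (b : B3plus) : exists u, b = braid (pos_word u) :> B3.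
Proof.
case: b => b /= /asboolP; elim=> {b} [|i|b c _ [u ->] _ [v ->]].
- by exists [::].
- by exists [:: i].
- by exists (u ++ v); rewrite /pos_word map_cat braid_cat.
Qed.

(** If [b b' = Delta_3 ^ l] with [b'] positive, the degree of [b] is at most
    that of [Delta_3 ^ l]. *)
Lemma size_pos_word (b : B3plus) u :
  b = braid (pos_word u) :> B3 -> (size u <= 3 * complexity b)%N.
Proof.
move=> bu; rewrite /complexity; case: ex_minnP => l /asboolP[b' bb'] _.
have [u' b'u'] := positive_braid_word b'.
have := deg_Delta3X l; rewrite -bb' /= degM bu b'u' !deg_braid !degree_pos.
lia.
Qed.

Definition words_upto (n : nat) : seq (seq 'I_2) :=
  [seq val u | u <- enum {: n.-bseq 'I_2}].

Lemma mem_words_upto n u : (size u <= n)%N -> u \in words_upto n.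
Proof.
by move=> le_u; apply/mapP; exists (Bseq le_u); rewrite ?mem_enum.
Qed.

Theorem propositionB (f : nat -> nat) : WO f.
Proof.
move=> k.
have [m mP] := bounded_descent (fun s => words_upto (3 * (k + f s))) rank_wf.
exists m => b size_b simple_b.
have /choice[c bc] := fun s => positive_braid_word (nth 1%g b s).
have [s le_s|s lt_s ndesc] := mP c.
  apply: mem_words_upto; apply: leq_trans (size_pos_word (bc s)) _.
  by rewrite leq_mul2l simple_b ?size_b.
by exists s => //; rewrite !bc => /braid_lt_rank.
Qed.
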